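(* Let $A=(a_{ij})\in\mathbb{R}^{n\times n}$ be the weighted adjacency matrix of a simple directed weighted graph on $V=\{1,\dots,n\}$ (real weights of arbitrary sign) satisfying Assumptions (A1), (A2), (A3) listed in the context, and let $L,\xi,\Xi,M,\kappa$ be as defined there. Let $v$ be a normalized eigenvector of $M$ for $\kappa$, i.e. $Mv=\kappa v$, $\|v\|_2=1$, and put $y=\Xi^{-1/2}v$. Then for every directed edge set $F$ on $V$ (not necessarily contained in the edge set of the graph), the generalized algebraic connectivity satisfies the first-order perturbation formula $$\partial_F\kappa=\sum_{j\to i\in F}\xi_i\,y_i\,(y_i-y_j)\;+\;y^\top(\partial_F\Xi)(L-\kappa I)\,y ,$$ where $\partial_F\kappa=\frac{d}{d\epsilon}\kappa(\epsilon)\big|_{\epsilon=0}$ and $\partial_F\Xi=\frac{d}{d\epsilon}\Xi(\epsilon)\big|_{\epsilon=0}$ are the derivatives along the perturbation $A(\epsilon)=A+\epsilon\sum_{j\to i\in F}E_{ij}$.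
   Context: Graph: $V=\{1,\dots,n\}$, $n\ge 2$; the graph is simple (no self-loops, at most one edge for each ordered pair). $a_{ij}\in\mathbb{R}$ is the weight of the directed edge $j\to i$ ($a_{ij}=0$ if there is no such edge); weights may be positive, zero or negative, and $A$ need not be symmetric. The Laplacian is $L=D-A$ with $D=\mathrm{diag}(k_1^{\mathrm{in}},\dots,k_n^{\mathrm{in}})$, $k_i^{\mathrm{in}}=\sum_{j=1}^n a_{ij}$; hence $L\mathbf{1}=0$ with $\mathbf{1}=(1,\dots,1)^\top$. Assumptions. (A1) $0$ is a simple eigenvalue of $L$, and every other eigenvalue $\lambda$ of $L$ satisfies $\Re(\lambda)>0$. (A2) The left eigenvector $\xi$ of $L$ for the eigenvalue $0$ ($\xi^\top L=0$) can be chosen entrywise positive and is normalized by $\mathbf{1}^\top\xi=1$. Put $\Xi=\mathrm{diag}(\xi_1,\dots,\xi_n)$ and define the real symmetric matrix $M=\Xi^{-1/2}\,\frac{\Xi L+L^\top\Xi}{2}\,\Xi^{-1/2}$. (A3) $M$ is positive semidefinite, and its second smallest eigenvalue $\kappa:=\lambda_2(M)$ satisfies $\kappa>0$ and is simple. The number $\kappa$ is called the generalized algebraic connectivity. Perturbation: a directed edge set $F$ on $V$ is a set of ordered pairs $j\to i$ of distinct vertices. $E_{ij}$ is the matrix unit with a $1$ in position $(i,j)$. For real $\epsilon$ with $|\epsilon|$ sufficiently small, $A(\epsilon)=A+\epsilon\sum_{j\to i\in F}E_{ij}$, and $L(\epsilon)$, $\xi(\epsilon)$ (left zero-eigenvector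 of $L(\epsilon)$ with $\mathbf{1}^\top\xi(\epsilon)=1$), $\Xi(\epsilon)=\mathrm{diag}(\xi(\epsilon))$, $M(\epsilon)$, $\kappa(\epsilon)=\lambda_2(M(\epsilon))$ (second smallest eigenvalue, counted with multiplicity) are the quantities built from $A(\epsilon)$ by the same formulas. *)

(* Defs.v *)
From HB Require Import structures.
From mathcomp Require Import all_boot all_order all_algebra.
From mathcomp Require Import all_classical all_reals all_analysis.
From mathcomp Require Import complex.

Set Implicit Arguments.
Unset Strict Implicit.
Unset Printing Implicit Defensive.

Import Order.TTheory GRing.Theory Num.Theory.
Import numFieldNormedType.Exports.

Local Open Scope classical_set_scope.
Local Open Scope ring_scope.

Section SignedDigraph.
Context {R : realType} {n : nat}.
Implicit Types A L M : 'M[R]_n.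

(* A i j is the weight of the edge j -> i; the graph has no self-loops. *)
Definition simple_weights A : Prop := forall i, A i i = 0.

Definition laplacian A : 'M[R]_n :=
  diag_mx (\row_i \sum_(j < n) A i j) - A.

Definition left_zero_vectors L : set 'cV[R]_n :=
  [set x | x^T *m L = 0 /\ \sum_(i < n) x i 0 = 1].

(* Total by choice; 0 when no left zero-eigenvector can be normalized. *)
Definition left_zero_vector A : 'cV[R]_n :=
  xget 0 (left_zero_vectors (laplacian A)).

Definition Xi A : 'M[R]_n := diag_mx (left_zero_vector A)^T.

(* Xi^(-1/2); meaningful when the entries of left_zero_vector A are positive. *)
Definition Xi_invsqrt A : 'M[R]_n :=
  diag_mx (\row_i (Num.sqrt (left_zero_vector A i 0))^-1).

Definition sym_laplacian A : 'M[R]_n :=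
  Xi_invsqrt A
  *m (2^-1 *: (Xi A *m laplacian A + (laplacian A)^T *m Xi A))
  *m Xi_invsqrt A.

(* The eigenvalues of M in increasing order, repeated according to
   multiplicity. Such a sequence is unique, and it exists for every real
   symmetric M; [::] is returned when char_poly M does not split over R. *)
Definition spectrum M : seq R :=
  xget [::] [set s | sorted <=%R s /\ char_poly M = \prod_(a <- s) ('X - a%:P)].

Definition lambda2 M : R := (spectrum M)`_1.

Definition gen_alg_connectivity A : R := lambda2 (sym_laplacian A).

Definition simple_eigenvalue M (a : R) : Prop := mup a (char_poly M) = 1%N.

Definition pos_semidef M : Prop :=
  forall x : 'cV[R]_n, 0 <= (x^T *m M *m x) 0 0.

Definition assumption_spectrum A : Prop :=
  simple_eigenvalue (laplacian A) 0 /\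
  forall z : R[i], eigenvalue (map_mx (real_complex R) (laplacian A)) z ->
    z != 0 -> 0 < complex.Re z.

Definition assumption_left_vector A : Prop :=
  left_zero_vectors (laplacian A) (left_zero_vector A) /\
  forall i, 0 < left_zero_vector A i 0.

Definition assumption_sym_laplacian A : Prop :=
  [/\ pos_semidef (sym_laplacian A),
      0 < gen_alg_connectivity A &
      simple_eigenvalue (sym_laplacian A) (gen_alg_connectivity A)].

Definition norm2 (x : 'cV[R]_n) : R := Num.sqrt (\sum_(i < n) x i 0 ^+ 2).

(* The pair (j, i) encodes the directed edge j -> i. *)
Definition edge_set (F : {set 'I_n * 'I_n}) : Prop :=
  forall e, e \in F -> e.1 != e.2.

Definition perturb A (F : {set 'I_n * 'I_n}) (eps : R) : 'M[R]_n :=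
  A + eps *: \sum_(e in F) delta_mx e.2 e.1.

End SignedDigraph.

(* Main.v *)
Require Import Defs.
From HB Require Import structures.
From mathcomp Require Import all_boot all_order all_algebra.
From mathcomp Require Import all_classical all_reals all_analysis.
From mathcomp Require Import perm spectral complex ring lra.

Set Implicit Arguments.
Unset Strict Implicit.
Unset Printing Implicit Defensive.

Import Order.TTheory GRing.Theory Num.Theory.
Import numFieldNormedType.Exports.

Local Open Scope classical_set_scope.
Local Open Scope ring_scope.

(** Write [S(e) = (Xi L + L^T Xi) / 2] for the perturbed data, so that
    [M(e) = Xi^(-1/2) S Xi^(-1/2)].  With [y(e) = Xi(e)^(-1/2) v(e)] the
    eigenequation of [M(e)] for [kappa(e)] is the generalized eigenequation
    [S(e) y(e) = kappa(e) Xi(e) y(e)], in which no square root is left to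
    differentiate.  Pairing the equation at [e] with [y] on the left, the
    equation at [0] with [y(e)] on the right, and subtracting
    ([eigenpair_difference]) gives the exact identity
      [(kappa(e) - kappa) y^T Xi(e) y(e)
         = y^T (S(e) - S) y(e) - kappa y^T (Xi(e) - Xi) y(e)].
    After division by [e], only the continuity of [y(e)], not its
    differentiability, is required to let [e] tend to [0]; since
    [y^T Xi y = 1], the limit is [y^T S' y - kappa y^T Xi' y].  The part
    [Xi L'] of [S'] contributes the sum over the edges, and the part [Xi' L]
    joins [- kappa Xi'] to form the second term of the formula.

    The differentiability of [xi] comes from linear algebra: [xi^T] is the
    unique solution of [x^T (L + J) = (1, ..., 1)], with [J] the all-ones
    matrix ([left_zero_vectorsP]), and [L + J] is invertible because the
    eigenvalue [0] of [L] is simple ([anchored_unitmx]).  Cramer's rule makes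
    the inverse continuous ([cvg_invmx]), and subtracting the equations at [e]
    and at [0] yields the derivative ([left_zero_vector_diffquot]).

    The continuity of the eigenpair [(kappa(e), v(e))] has two ingredients.
    A Courant-Fischer argument bounds the variation of the second smallest
    eigenvalue of a symmetric matrix by the sum of the absolute values of the
    changes of its entries ([lambda2_lipschitz]).  Since [kappa] is simple,
    [M - kappa I + v v^T] is invertible, and so is
    [C(e) = M(e) - kappa(e) I + v v^T] for small [e]; the solution of
    [C(e) w = v] is an eigenvector of [M(e)] ([bordered_eigenvector]) and tends
    to [v] ([cvg_lambda2_eigenvector]).

    Both simplicity arguments rest on one bordering lemma
    ([bordered_unitmx]), itself a consequence of the fact that a simple root of
    the characteristic polynomial has a one-dimensional eigenspace
    ([simple_eigenspace]).  That fact and the orthogonal diagonalization of real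
    symmetric matrices ([symmetric_diagonalization]) both follow by deflation
    along an eigenvector with a Householder reflection ([deflation]). *)

(** * Orthogonal reduction of real matrices *)

Section Orthogonal.
Context {R : rcfType}.

Lemma sqnormE n (x : 'cV[R]_n) : (x^T *m x) 0 0 = \sum_i x i 0 ^+ 2.
Proof. by rewrite mxE; apply: eq_bigr => i _; rewrite mxE expr2. Qed.

Lemma sqnorm_ge0 n (x : 'cV[R]_n) : 0 <= (x^T *m x) 0 0.
Proof. by rewrite sqnormE sumr_ge0 // => i _; exact: sqr_ge0. Qed.

Lemma sqnorm_eq0 n (x : 'cV[R]_n) : ((x^T *m x) 0 0 == 0) = (x == 0).
Proof.
apply/eqP/eqP => [|->]; last by rewrite mulmx0 mxE.
rewrite sqnormE => /eqP; rewrite psumr_eq0 => [/allP x0|i _]; last exact: sqr_ge0.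
apply/matrixP => i j; rewrite ord1 mxE.
by apply/eqP; have := x0 i (mem_index_enum i); rewrite sqrf_eq0.
Qed.

Lemma sqnorm_gt0 n (x : 'cV[R]_n) : x != 0 -> 0 < (x^T *m x) 0 0.
Proof. by move=> x0; rewrite lt0r sqnorm_ge0 sqnorm_eq0 x0. Qed.

(** Over the complex numbers the matrix is Hermitian, so the spectral theorem
    supplies a real eigenvalue; a real matrix that is singular over the complex
    numbers is singular over the reals, hence the eigenvector can be taken
    real. *)
Lemma symmetric_eigenvector n (M : 'M[R]_n.+1) : M^T = M ->
  exists a, exists2 v : 'cV_n.+1, v^T *m v = 1%:M & M *m v = a *: v.
Proof.
move=> symM; pose A := map_mx (real_complex R) M.
have hermA : A \is hermsymmx.
  apply: realsym_hermsym.
    by apply/is_hermitianmxP; rewrite expr0 scale1r map_mx_id // /A map_trmx symM.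
  by apply/mxOverP => i j; rewrite mxE complex_real.
have /orthomx_spectralP Adiag := hermitian_normalmx hermA.
have := hermitian_spectral_diag_real hermA.
move: Adiag (spectral_unit A).
set P := spectralmx A; set d := spectral_diag A => Adiag Punit /mxOverP dreal.
have rowP : row 0 P *m A = d 0 0 *: row 0 P.
  rewrite {1}Adiag -row_mul !mulmxA mulmxV // mul1mx row_mul row_diag_mx.
  by rewrite -scalemxAl -rowE.
have rowP0 : row 0 P != 0.
  apply/eqP => /(congr1 (mulmx^~ (invmx P))); rewrite -row_mul mulmxV // mul0mx.
  by move/matrixP/(_ 0 0); rewrite !mxE eqxx => /eqP; rewrite oner_eq0.
have [a da] : exists a, d 0 0 = real_complex R a.
  by exists (complex.Re (d 0 0)); rewrite RRe_real.
have /eigenvalueP[x xM x0] : eigenvalue M a.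
  rewrite -(eigenvalue_map (real_complex R)).
  by apply/eigenvalueP; exists (row 0 P); rewrite // rowP da.
have MxT : M *m x^T = a *: x^T by rewrite -{1}symM -trmx_mul xM linearZ.
have xT0 : x^T != 0 by rewrite trmx_eq0.
have nx := sqnorm_gt0 xT0.
exists a, ((Num.sqrt ((x^T^T *m x^T) 0 0))^-1 *: x^T).
  rewrite -scalemxAr linearZ /= -scalemxAl scalerA -expr2 exprVn sqr_sqrtr ?ltW //.
  by rewrite [X in _ *: X]mx11_scalar scale_scalar_mx mulVf ?gt_eqF.
by rewrite -scalemxAr MxT scalerA mulrC -scalerA.
Qed.

(** The Householder reflection in the hyperplane orthogonal to [v - e]. *)
Lemma reflection_onto_unit n (e v : 'cV[R]_n) :
    e^T *m e = 1%:M -> v^T *m v = 1%:M ->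
  exists H : 'M[R]_n, [/\ H^T = H, H *m H = 1%:M & H *m e = v].
Proof.
move=> e1 v1; have [->|neq_ve] := eqVneq v e.
  by exists 1%:M; rewrite trmx1 mulmx1 mul1mx.
pose w := v - e; pose c := (w^T *m w) 0 0.
have c0 : c != 0 by rewrite sqnorm_eq0 subr_eq0.
have wwE : w^T *m w = c%:M by rewrite [LHS]mx11_scalar.
have weE : w^T *m e = (- c / 2)%:M.
  have eqve : v^T *m e = e^T *m v.
    by rewrite -[LHS]trmxK trmx_mul trmxK [LHS]mx11_scalar [RHS]mx11_scalar mxE.
  rewrite [LHS]mx11_scalar; congr (_%:M).
  rewrite /c /w linearB /= mulmxBr !mulmxBl v1 e1 eqve !mxE /=.
  by field.
exists (1%:M - (2 / c) *: (w *m w^T)); split.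
- by rewrite linearB /= trmx1 linearZ /= trmx_mul trmxK.
- rewrite mulmxBl mul1mx mulmxBr mulmx1 -scalemxAl -scalemxAr.
  rewrite -[w *m w^T *m _]mulmxA [w^T *m _]mulmxA wwE mul_scalar_mx -scalemxAr !scalerA.
  have -> : 2 / c * (2 / c * c) = 2 / c + 2 / c by field.
  by rewrite scalerDl opprB addrK subrK.
- rewrite mulmxBl mul1mx -scalemxAl -mulmxA weE mul_mx_scalar scalerA.
  have -> : 2 / c * (- c / 2) = -1 by field.
  by rewrite scaleN1r opprK addrC subrK.
Qed.

(** Conjugating by a reflection that sends the first basis vector to the
    eigenvector [v] clears the first column below the diagonal; [C] is what is
    left of [M] once [v] has been split off. *)
Lemma deflation n (M : 'M[R]_(1 + n)) a (v : 'cV[R]_(1 + n)) :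
    v^T *m v = 1%:M -> M *m v = a *: v ->
  exists H : 'M[R]_(1 + n), exists B C, [/\ H^T = H, H *m H = 1%:M,
    H *m col_mx 1%:M 0 = v & H *m M *m H = block_mx a%:M B 0 C].
Proof.
move=> v1 Mv; pose e : 'cV[R]_(1 + n) := col_mx 1%:M 0.
have e1 : e^T *m e = 1%:M.
  by rewrite tr_col_mx mul_row_col trmx0 mul0mx addr0 trmx1 mul1mx.
have [H [HT HH He]] := reflection_onto_unit e1 v1.
pose N : 'M[R]_(1 + n) := H *m M *m H.
have Ne : N *m e = a *: e.
  by rewrite -mulmxA He -mulmxA Mv -scalemxAr -He mulmxA HH mul1mx.
exists H, (ursubmx N), (drsubmx N); split=> //; rewrite -/N -[LHS]submxK.
move: Ne; rewrite -{1}[N]submxK mul_block_col !mulmx0 !mulmx1 !addr0.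
by rewrite scale_col_mx scalemx1 scaler0 => /eq_col_mx[-> ->].
Qed.

Lemma symmetric_diagonalization n (M : 'M[R]_n) : M^T = M ->
  exists Q : 'M[R]_n, exists2 d : 'rV[R]_n,
    Q *m Q^T = 1%:M & M = Q^T *m diag_mx d *m Q.
Proof.
elim: n M => [|n IHn] M symM.
  by exists 1%:M, 0; [rewrite trmx1 mulmx1 | rewrite [LHS]flatmx0 [RHS]flatmx0].
rewrite -[n.+1]/(1 + n)%N in M symM *.
have [a [v v1 Mv]] := symmetric_eigenvector symM.
have [H [B [C [HT HH _ HMH]]]] := deflation v1 Mv.
have : (block_mx a%:M B 0 C)^T = block_mx a%:M B 0 C.
  by rewrite -HMH !trmx_mul symM HT mulmxA.
rewrite tr_block_mx trmx0 => /eq_block_mx[_ /esym B0 _ symC].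
have [Q [d QQ Cd]] := IHn C symC.
exists (block_mx 1%:M 0 0 Q *m H), (row_mx a%:M d).
  rewrite trmx_mul HT mulmxA -[_ *m H *m H]mulmxA HH mulmx1.
  rewrite tr_block_mx !trmx0 trmx1 mulmx_block !mulmx0 !mul0mx !addr0 !add0r mulmx1 QQ.
  by rewrite -scalar_mx_block.
have -> : M = H *m (H *m M *m H) *m H by rewrite !mulmxA HH mul1mx -mulmxA HH mulmx1.
rewrite HMH B0 Cd diag_mx_row.
have -> : diag_mx a%:M = a%:M :> 'M[R]_1.
  by apply/matrixP => i j; rewrite !ord1 !mxE.
rewrite trmx_mul HT tr_block_mx !trmx0 trmx1 !mulmxA; congr (_ *m _).
rewrite -!mulmxA.
by rewrite !mulmx_block !(mulmx0, mul0mx, addr0, add0r) mulmx1 !mul1mx.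
Qed.

Lemma unitmx_kernel (F : fieldType) n (A : 'M[F]_n) :
  (forall x : 'cV[F]_n, A *m x = 0 -> x = 0) -> A \in unitmx.
Proof.
move=> kerA; rewrite -unitmx_tr unitmxE unitfE; apply/det0P => -[x x0 xA].
move/eqP: x0; apply; apply: trmx_inj; rewrite trmx0; apply: kerA.
by rewrite -[A]trmxK -trmx_mul xA trmx0.
Qed.

Lemma char_poly_conj (S : comNzRingType) n (P P' A : 'M[S]_n) :
  P *m P' = 1%:M -> char_poly (P *m A *m P') = char_poly A.
Proof.
move=> PP'.
have XE : char_poly_mx (P *m A *m P') =
    map_mx polyC P *m char_poly_mx A *m map_mx polyC P'.
  rewrite /char_poly_mx mulmxBr mulmxBl !map_mxM; congr (_ - _).
  by rewrite mul_mx_scalar -scalemxAl -map_mxM PP' map_mx1 scalemx1.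
rewrite /char_poly XE !det_mulmx mulrAC -det_mulmx -map_mxM PP' map_mx1.
by rewrite det1 mul1r.
Qed.

Lemma char_poly_ublock (S : comNzRingType) m n
    (A : 'M[S]_m) (B : 'M[S]_(m, n)) (C : 'M[S]_n) :
  char_poly (block_mx A B 0 C) = char_poly A * char_poly C.
Proof.
rewrite /char_poly /char_poly_mx map_block_mx map_mx0 scalar_mx_block.
by rewrite opp_block_mx add_block_mx add0r oppr0 addr0 det_ublock.
Qed.

(** After deflation along [v] the characteristic polynomial is
    [('X - a) * char_poly C].  An eigenvector independent of [v] would make [a]
    an eigenvalue of [C] as well, hence a multiple root. *)
Lemma simple_eigenspace n (M : 'M[R]_n) a (v x : 'cV[R]_n) :
    mup a (char_poly M) = 1%N -> v != 0 -> M *m v = a *: v -> M *m x = a *: x ->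
  exists c, x = c *: v.
Proof.
case: n M v x => [|n] M v x simp v0 Mv Mx.
  by exists 0; rewrite [LHS]flatmx0 [RHS]flatmx0.
rewrite -[n.+1]/(1 + n)%N in M v x simp v0 Mv Mx *.
pose r := Num.sqrt ((v^T *m v) 0 0).
have r0 : r != 0 by rewrite gt_eqF // sqrtr_gt0 sqnorm_gt0.
have v1 : (r^-1 *: v)^T *m (r^-1 *: v) = 1%:M.
  rewrite -scalemxAr linearZ /= -scalemxAl scalerA [X in _ *: X]mx11_scalar.
  by rewrite -expr2 exprVn sqr_sqrtr ?sqnorm_ge0 // scale_scalar_mx mulVf // sqnorm_eq0.
have [|H [B [C [_ HH He HMH]]]] := deflation v1 (a := a) (M := M).
  by rewrite -scalemxAr Mv scalerA mulrC -scalerA.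
have chM : char_poly M = ('X - a%:P) * char_poly C.
  rewrite -(char_poly_conj M HH) HMH char_poly_ublock; congr (_ * _).
  by rewrite char_poly_trig ?scalar_mx_is_trig // big_ord1 mxE eqxx.
have Caunit : C - a%:M \in unitmx.
  rewrite -row_free_unit -kermx_eq0 -[kermx _]/(eigenspace C a).
  apply: contraPT simp; rewrite -/(eigenvalue C a) eigenvalue_root_char => rootC.
  have C0 : char_poly C != 0 by rewrite monic_neq0 // char_poly_monic.
  rewrite chM mupM ?polyXsubC_eq0 // (@mup_XsubCX _ 1) eqxx /=.
  by move: rootC; rewrite -dvdp_XsubCl XsubC_dvd //; case: mup.
pose w := H *m x.
have xw : x = H *m w by rewrite mulmxA HH mul1mx.
have : H *m M *m H *m w = a *: w.
  by rewrite -[_ *m H *m w]mulmxA -xw -mulmxA Mx scalemxAr.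
rewrite HMH -[w]vsubmxK mul_block_col mul0mx add0r scale_col_mx => /eq_col_mx[_ Cw].
have w1 : dsubmx w = 0.
  by rewrite -[LHS](mulKmx Caunit) mulmxBl Cw mul_scalar_mx subrr mulmx0.
exists (usubmx w 0 0 * r^-1).
rewrite -scalerA -He scalemxAr scale_col_mx scaler0 xw -{1}[w]vsubmxK w1.
by rewrite scalemx1 -mx11_scalar.
Qed.

(** Adding [p q^T] repairs the corank one of [M - a]: the left eigenvector [u]
    detects that a kernel vector [x] satisfies [q^T x = 0], so [x] is an
    eigenvector, hence a multiple of [v], and [q^T v] does not vanish. *)
Lemma bordered_unitmx n (M : 'M[R]_n) a (u v p q : 'cV[R]_n) :
    mup a (char_poly M) = 1%N -> M *m v = a *: v -> u^T *m M = a *: u^T ->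
    (u^T *m p) 0 0 != 0 -> (q^T *m v) 0 0 != 0 ->
  M - a%:M + p *m q^T \in unitmx.
Proof.
move=> simp Mv uM up qv; apply: unitmx_kernel => x Cx.
have qx : q^T *m x = 0.
  have := congr1 (mulmx u^T) Cx.
  rewrite mulmx0 mulmxA mulmxDr mulmxBr uM mul_mx_scalar subrr add0r -!mulmxA.
  rewrite [q^T *m x]mx11_scalar mul_mx_scalar -scalemxAr => /matrixP/(_ 0 0).
  by rewrite mxE [RHS]mxE => /eqP; rewrite mulf_eq0 (negPf up) orbF => /eqP->; rewrite raddf0.
move: Cx; rewrite mulmxDl -mulmxA qx mulmx0 addr0 mulmxBl mul_scalar_mx => /eqP.
rewrite subr_eq0 => /eqP Mx.
have v0 : v != 0 by apply: contraNneq qv => ->; rewrite mulmx0 mxE.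
have [c xc] := simple_eigenspace simp v0 Mv Mx.
move/matrixP/(_ 0 0)/eqP: qx; rewrite xc -scalemxAr mxE [X in _ == X]mxE.
by rewrite mulf_eq0 (negPf qv) orbF => /eqP->; rewrite scale0r.
Qed.

End Orthogonal.

(** * The ordered spectrum of a real symmetric matrix *)

Section Spectrum.
Context {R : realType}.

Lemma spectrum_unique n (M : 'M[R]_n) s :
  sorted <=%R s -> char_poly M = \prod_(a <- s) ('X - a%:P) -> spectrum M = s.
Proof.
move=> s_sorted Ms; rewrite /spectrum; case: xgetP => [t -> [t_sorted Mt]|/(_ s)].
  apply: (sorted_eq le_trans le_anti) => //.
  by apply: prod_XsubC_eq; rewrite -Ms.
by case; split.
Qed.

(** The diagonal found by deflation comes in no particular order; a permutation
    matrix sorts it, which identifies it with the increasing sequence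
    [spectrum M]. *)
Lemma spectral_theorem n (M : 'M[R]_n) : M^T = M ->
  char_poly M = \prod_(a <- spectrum M) ('X - a%:P) /\
  [/\ sorted <=%R (spectrum M), size (spectrum M) = n &
    exists2 Q : 'M[R]_n, Q *m Q^T = 1%:M &
      M = Q^T *m diag_mx (\row_i (spectrum M)`_i) *m Q].
Proof.
move=> symM; have [Q [d QQ Md]] := symmetric_diagonalization symM.
have QTQ := mulmx1C QQ.
pose dt := [tuple d 0 i | i < n].
have MdP : char_poly M = \prod_(a <- dt) ('X - a%:P).
  rewrite Md char_poly_conj // char_poly_trig ?diag_mx_is_trig //.
  by rewrite big_map big_enum; apply: eq_bigr => i _; rewrite mxE eqxx.
pose s := sort_tuple <=%R dt.
have s_sorted : sorted <=%R s by apply: sort_sorted; exact: le_total.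
have perm_s : perm_eq s dt by rewrite perm_sort.
have -> : spectrum M = s.
  by apply: spectrum_unique; rewrite ?MdP //; apply: perm_big; rewrite perm_sym.
split; first by rewrite MdP; apply: perm_big; rewrite perm_sym.
split; rewrite ?size_tuple //.
have /tuple_permP[p sp] := perm_s.
pose P : 'M[R]_n := perm_mx p.
have PP : P *m P^T = 1%:M by rewrite tr_perm_mx -perm_mxM fingroup.mulgV perm_mx1.
exists (P *m Q).
  by rewrite trmx_mul mulmxA -[_ *m Q *m _]mulmxA QQ mulmx1.
have sPd : diag_mx (\row_i s`_i) *m P = P *m diag_mx d.
  apply/matrixP => i j; rewrite mul_diag_mx mul_mx_diag !mxE.
  rewrite sp (nth_map i) ?size_enum_ord // nth_ord_enum tnth_mktuple.
  by case: eqP => [->|]; rewrite ?mulr0 ?mul0r // mulrC.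
rewrite Md trmx_mul -!mulmxA; congr (_ *m _).
by rewrite ![in RHS]mulmxA -[_ *m _ *m P]mulmxA sPd mulmxA (mulmx1C PP) mul1mx.
Qed.
End Spectrum.

(** * Perturbation of the second eigenvalue *)

Section SymmetricSpectrum.
Context {R : realType}.

Lemma diag_quadform n (d : 'rV[R]_n) (t : 'cV[R]_n) :
  (t^T *m diag_mx d *m t) 0 0 = \sum_i d 0 i * t i 0 ^+ 2.
Proof.
rewrite -mulmxA mxE; apply: eq_bigr => i _.
by rewrite mul_diag_mx !mxE mulrCA expr2.
Qed.

Lemma quadform_bound n (D : 'M[R]_n) (x : 'cV[R]_n) :
  (x^T *m D *m x) 0 0 <= (\sum_i \sum_j `|D i j|) * (x^T *m x) 0 0.
Proof.
have xx i j : `|x i 0 * x j 0| <= (x^T *m x) 0 0.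
  have xi k : x k 0 ^+ 2 <= (x^T *m x) 0 0.
    rewrite sqnormE (bigD1 k) //= lerDl sumr_ge0 // => l _; exact: sqr_ge0.
  have := xi i; have := xi j; rewrite ler_norml.
  have := sqr_ge0 (x i 0 - x j 0); have := sqr_ge0 (x i 0 + x j 0).
  move: (_ 0 0) => c; nra.
set c := (x^T *m x) 0 0 in xx *; clearbody c.
rewrite mxE exchange_big mulr_suml; apply: ler_sum => j _.
rewrite !mxE !mulr_suml; apply: ler_sum => i _; rewrite mxE.
rewrite (le_trans (ler_norm _)) // mulrAC mulrC normrM.
by rewrite ler_wpM2l.
Qed.

(** Courant-Fischer argument.  The plane spanned by the two lowest eigenvectors
    of [N] contains a nonzero [x] orthogonal to the lowest eigenvector of [M].
    The quadratic form of [N] at [x] is at most [lambda2 N] times the squared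
    norm of [x], that of [M] is at least [lambda2 M] times it, and the two forms
    differ by at most the sum of the entries of [M - N] in absolute value times
    it. *)
Lemma lambda2_lipschitz n (M N : 'M[R]_n) : (2 <= n)%N -> M^T = M -> N^T = N ->
  lambda2 M <= lambda2 N + \sum_i \sum_j `|M i j - N i j|.
Proof.
case: n M N => [|[|n]] M N // _ symM symN.
have [_ [sM zM [P PP PM]]] := spectral_theorem symM.
have [_ [sN zN [Q QQ QN]]] := spectral_theorem symN.
rewrite /lambda2; set s := spectrum M in sM zM PM *; set r := spectrum N in sN zN QN *.
pose i0 : 'I_n.+2 := ord0; pose i1 : 'I_n.+2 := lift ord0 ord0.
(* [c k] is the scalar product of the lowest eigenvector of [M] with the k-th
   eigenvector of [N]. *)
pose c k := (P *m Q^T) i0 k.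
have [a [b [ab ab0]]] : exists a b, a * c i0 + b * c i1 = 0 /\ (a != 0) || (b != 0).
  have [c0|c0] := eqVneq (c i0) 0.
    by exists 1, 0; rewrite c0 mulr0 mul0r addr0 oner_eq0.
  by exists (- c i1), (c i0); rewrite c0 orbT mulNr mulrC addNr.
(* The coordinates of [x] in the eigenbasis of [N]. *)
pose t : 'cV[R]_n.+2 := \col_i (if i == i0 then a else if i == i1 then b else 0).
pose x := Q^T *m t.
have tP : t != 0.
  apply/eqP => t0; have := congr1 (fun u : 'cV[R]_n.+2 => u i0 0) t0.
  have := congr1 (fun u : 'cV[R]_n.+2 => u i1 0) t0.
  by rewrite /t !mxE /= => b0 a0; rewrite a0 b0 eqxx in ab0.
have Qx : Q *m x = t by rewrite mulmxA QQ mul1mx.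
have xt : x^T *m x = t^T *m t.
  by rewrite /x trmx_mul trmxK -mulmxA [Q *m _]mulmxA QQ mul1mx.
have x_gt0 : 0 < (x^T *m x) 0 0 by rewrite xt sqnorm_gt0.
have Px0 : (P *m x) i0 0 = 0.
  rewrite /x mulmxA mxE (bigD1 i0) // (bigD1 i1) //= -/(c _) -/(c _) big1.
    by rewrite /t !mxE /= addr0 mulrC [c i1 * _]mulrC.
  by move=> i /andP[/negPf i0P /negPf i1P]; rewrite [t _ _]mxE i0P i1P mulr0.
have {}Qx := esym Qx; clearbody x.
have lowM : s`_1 * (x^T *m x) 0 0 <= (x^T *m M *m x) 0 0.
  have -> : x^T *m x = (P *m x)^T *m (P *m x).
    by rewrite trmx_mul -mulmxA [P^T *m _]mulmxA (mulmx1C PP) mul1mx.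
  have -> : x^T *m M *m x = (P *m x)^T *m diag_mx (\row_i s`_i) *m (P *m x).
    by rewrite PM trmx_mul !mulmxA.
  rewrite diag_quadform sqnormE mulr_sumr; apply: ler_sum => i _.
  rewrite [X in _ <= X * _]mxE; have [->|i_neq0] := eqVneq i i0.
    by rewrite Px0 expr0n !mulr0.
  rewrite ler_wpM2r ?sqr_ge0 //.
  apply: (sorted_leq_nth le_trans le_refl) => //; rewrite ?inE ?zM //.
  by rewrite lt0n -(inj_eq val_inj) in i_neq0 *.
have upN : (x^T *m N *m x) 0 0 <= r`_1 * (x^T *m x) 0 0.
  have -> : x^T *m N *m x = t^T *m diag_mx (\row_i r`_i) *m t.
    by rewrite QN Qx trmx_mul !mulmxA.
  rewrite xt diag_quadform sqnormE mulr_sumr; apply: ler_sum => i _.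
  rewrite [X in X * _ <= _]mxE; have [->|i_neq0] := eqVneq i i0.
    rewrite ler_wpM2r ?sqr_ge0 //.
    by apply: (sorted_leq_nth le_trans le_refl) => //; rewrite ?inE ?zN.
  have [->//|i_neq1] := eqVneq i i1.
  by rewrite mxE (negPf i_neq0) (negPf i_neq1) expr0n !mulr0.
have := quadform_bound (M - N) x.
rewrite mulmxBr mulmxBl mxE [X in _ + X <= _]mxE lerBlDr => bd.
rewrite -(ler_pM2r x_gt0) mulrDl (le_trans lowM) // (le_trans bd) //.
rewrite addrC lerD // ler_wpM2r ?(ltW x_gt0) //; apply: ler_sum => i _; apply: ler_sum => j _.
by rewrite !mxE.
Qed.

Lemma lambda2_eigenvector n (M : 'M[R]_n) : (2 <= n)%N -> M^T = M ->
  exists2 z : 'cV[R]_n, z != 0 & M *m z = lambda2 M *: z.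
Proof.
move=> n_ge2 symM; have [Ms [_ zM _]] := spectral_theorem symM.
have /eigenvalueP[z zM' z0] : eigenvalue M (lambda2 M).
  by rewrite eigenvalue_root_char Ms root_prod_XsubC mem_nth // zM.
exists z^T; first by rewrite trmx_eq0.
by rewrite -{1}symM -trmx_mul zM' linearZ.
Qed.

Lemma symmetric_bordered_unitmx n (M : 'M[R]_n) a (v : 'cV[R]_n) :
    M^T = M -> simple_eigenvalue M a ->
    v^T *m v = 1%:M -> M *m v = a *: v ->
  M - a%:M + v *m v^T \in unitmx.
Proof.
move=> symM simp v1 Mv; apply: (bordered_unitmx (v := v) (u := v) simp Mv); last first.
- by rewrite v1 mxE eqxx oner_eq0.
- by rewrite v1 mxE eqxx oner_eq0.
by rewrite -{1}symM -trmx_mul Mv linearZ.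
Qed.

(** For an eigenvector [z] the bordered matrix maps [z] to [(v^T z) v], so the
    solution of the regular system with right-hand side [v] is proportional to
    [z].  Unlike the choice of an eigenvector, this solution depends
    continuously on [M] and [a]. *)
Lemma bordered_eigenvector n (M : 'M[R]_n) a (v z : 'cV[R]_n) :
    M - a%:M + v *m v^T \in unitmx -> z != 0 -> M *m z = a *: z ->
  M *m (invmx (M - a%:M + v *m v^T) *m v) =
  a *: (invmx (M - a%:M + v *m v^T) *m v).
Proof.
set C := _ + _ => Cunit z0 Mz; pose c := (v^T *m z) 0 0.
have Cz : C *m z = c *: v.
  rewrite mulmxDl mulmxBl Mz mul_scalar_mx subrr add0r -mulmxA.
  by rewrite [v^T *m z]mx11_scalar mul_mx_scalar.
have c0 : c != 0.
  apply: contraNneq z0 => c0; rewrite -(mulKmx Cunit z) Cz c0.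
  by rewrite scale0r mulmx0.
have -> : invmx C *m v = c^-1 *: z.
  by rewrite -(mulKmx Cunit z) Cz -!scalemxAr scalerA mulVf // scale1r.
by rewrite -scalemxAr Mz scalerA mulrC -scalerA.
Qed.

End SymmetricSpectrum.

(** * Limits of matrix-valued functions *)

Section MatrixLimits.
Context {R : realType} {T : Type} {F : set_system T} {FF : Filter F}.

Lemma cvg_mxP m n (f : T -> 'M[R]_(m, n)) (l : 'M[R]_(m, n)) :
  f @ F --> l <-> forall i j, f x i j @[x --> F] --> l i j.
Proof.
split=> [fl i j|fl].
  apply: (cvg_comp f (fun M : 'M[R]_(m, n) => M i j) fl).
  exact: coord_continuous.
apply/cvgrPdist_le => e e0; near=> x.
rewrite /Num.Def.normr/= mx_normrE (bigmax_le _ (ltW e0)) //= => i _.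
rewrite !mxE; move: i; near: x; apply: filter_forall => i.
exact: ((cvgrPdist_le _ _).1 (fl i.1 i.2)).
Unshelve. all: by end_near. Qed.

Lemma cvg_bigsum (I : Type) (r : seq I) (P : pred I) (f : I -> T -> R) (l : I -> R) :
  (forall i, P i -> f i @ F --> l i) ->
  \sum_(i <- r | P i) f i x @[x --> F] --> \sum_(i <- r | P i) l i.
Proof. by move=> fl; apply: cvg_big fl; exact: add_continuous. Qed.

Lemma cvg_bigprod (I : Type) (r : seq I) (P : pred I) (f : I -> T -> R) (l : I -> R) :
  (forall i, P i -> f i @ F --> l i) ->
  \prod_(i <- r | P i) f i x @[x --> F] --> \prod_(i <- r | P i) l i.
Proof. by move=> fl; apply: cvg_big fl; exact: mul_continuous. Qed.

Lemma cvg_mulmx m n p (f : T -> 'M[R]_(m, n)) (g : T -> 'M[R]_(n, p))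
    (A : 'M[R]_(m, n)) (B : 'M[R]_(n, p)) :
  f @ F --> A -> g @ F --> B -> f x *m g x @[x --> F] --> A *m B.
Proof.
move=> /cvg_mxP fA /cvg_mxP gB; apply/cvg_mxP => i j; rewrite mxE.
under eq_cvg do rewrite mxE.
by apply: cvg_bigsum => k _; apply: cvgM.
Qed.

Lemma cvg_trmx m n (f : T -> 'M[R]_(m, n)) (A : 'M[R]_(m, n)) :
  f @ F --> A -> (f x)^T @[x --> F] --> A^T.
Proof.
move=> /cvg_mxP fA; apply/cvg_mxP => i j; rewrite mxE.
under eq_cvg do rewrite mxE.
exact: fA.
Qed.

Lemma cvg_diag_mx n (f : T -> 'rV[R]_n) (d : 'rV[R]_n) :
  f @ F --> d -> diag_mx (f x) @[x --> F] --> diag_mx d.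
Proof.
move=> /cvg_mxP fd; apply/cvg_mxP => i j; rewrite mxE.
under eq_cvg do rewrite mxE.
by case: eqP => [->|_]; rewrite ?mulr1n ?mulr0n; [exact: fd|exact: cvg_cst].
Qed.

Lemma cvg_det n (f : T -> 'M[R]_n) (A : 'M[R]_n) :
  f @ F --> A -> \det (f x) @[x --> F] --> \det A.
Proof.
move=> /cvg_mxP fA; apply: cvg_bigsum => s _.
by apply: cvgM; [exact: cvg_cst | apply: cvg_bigprod => i _; exact: fA].
Qed.

Lemma cvg_adjmx n (f : T -> 'M[R]_n) (A : 'M[R]_n) :
  f @ F --> A -> \adj (f x) @[x --> F] --> \adj A.
Proof.
move=> /cvg_mxP fA; apply/cvg_mxP => i j; rewrite mxE.
under eq_cvg do rewrite mxE.
apply: cvgM; [exact: cvg_cst | apply: cvg_det].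
apply/cvg_mxP => k l; rewrite !mxE.
under eq_cvg do rewrite !mxE.
exact: fA.
Qed.

Lemma near_unitmx n (f : T -> 'M[R]_n) (A : 'M[R]_n) :
  f @ F --> A -> A \in unitmx -> \forall x \near F, f x \in unitmx.
Proof.
move=> fA; rewrite unitmxE unitfE => A0.
near=> x; rewrite unitmxE unitfE; near: x.
exact: cvgr_neq0 (cvg_det fA) A0.
Unshelve. all: by end_near. Qed.

Lemma cvg_invmx n (f : T -> 'M[R]_n) (A : 'M[R]_n) :
  f @ F --> A -> A \in unitmx -> invmx (f x) @[x --> F] --> invmx A.
Proof.
move=> fA Aunit; rewrite {2}/invmx Aunit.
apply: (@cvg_trans _ (((\det (f x))^-1 *: \adj (f x)) @[x --> F])).
  apply: near_eq_cvg; near=> x; rewrite /invmx ifT //.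
  by near: x; exact: near_unitmx fA Aunit.
apply: cvgZ; last exact: (cvg_adjmx fA).
apply: (cvgV _ (cvg_det fA)). by rewrite -unitfE -unitmxE.
Unshelve. all: by end_near. Qed.

Lemma cvg_lambda2 n (f : T -> 'M[R]_n) (M : 'M[R]_n) : (2 <= n)%N ->
    (forall x, (f x)^T = f x) -> M^T = M ->
  f @ F --> M -> lambda2 (f x) @[x --> F] --> lambda2 M.
Proof.
move=> n_ge2 symf symM fM.
pose gap x := \sum_i \sum_j `|f x i j - M i j|.
have gap0 : gap @ F --> 0.
  rewrite -[X in _ --> X](_ : \sum_(i < n) \sum_(j < n) 0 = 0 :> R); last first.
    by rewrite big1 // => i _; rewrite big1.
  apply: cvg_bigsum => i _; apply: cvg_bigsum => j _.
  by apply/norm_cvg0P/subr_cvg0; move/cvg_mxP: fM; exact.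
apply/subr_cvg0; apply: (@squeeze_cvgr _ _ _ _ (fun x => - gap x) gap) => //; last first.
  by rewrite -oppr0; exact: cvgN.
apply: nearW => x; rewrite lerBlDl lerBrDl lerBlDr.
rewrite !lambda2_lipschitz // andbT.
have := lambda2_lipschitz n_ge2 symM (symf x).
by under eq_bigr do under eq_bigr do rewrite distrC.
Qed.

(** The bordered system singles out one eigenvector of each [f x]; in the limit
    its solution is [v] because [(M - lambda2 M + v v^T) v = v]. *)
Lemma cvg_lambda2_eigenvector n (f : T -> 'M[R]_n) (M : 'M[R]_n) (v : 'cV[R]_n) :
    (2 <= n)%N ->
    (forall x, (f x)^T = f x) -> M^T = M -> f @ F --> M ->
    simple_eigenvalue M (lambda2 M) ->
    v^T *m v = 1%:M -> M *m v = lambda2 M *: v ->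
  exists g : T -> 'cV[R]_n, g @ F --> v /\
    \forall x \near F, f x *m g x = lambda2 (f x) *: g x.
Proof.
move=> n_ge2 symf symM fM simp v1 Mv.
pose C (N : 'M[R]_n) := N - (lambda2 N)%:M + v *m v^T.
have Cunit : C M \in unitmx by exact: symmetric_bordered_unitmx.
have fC : C (f x) @[x --> F] --> C M.
  apply: cvgD; last exact: cvg_cst.
  apply: cvgB => //; rewrite -diag_const_mx.
  under eq_cvg do rewrite -diag_const_mx.
  apply: cvg_diag_mx; apply/cvg_mxP => i j; rewrite mxE.
  under eq_cvg do rewrite mxE.
  exact: cvg_lambda2 fM.
exists (fun x => invmx (C (f x)) *m v); split.
  have vE : invmx (C M) *m v = v.
    apply: (canLR (mulKmx Cunit)); rewrite mulmxDl mulmxBl Mv mul_scalar_mx subrr.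
    by rewrite add0r -mulmxA v1 mulmx1.
  rewrite -[X in _ --> X]vE.
  by apply: cvg_mulmx; [exact: cvg_invmx fC Cunit | exact: cvg_cst].
near=> x.
have Cxunit : C (f x) \in unitmx by near: x; exact: (near_unitmx fC).
have [z z0 fz] := lambda2_eigenvector n_ge2 (symf x).
exact: bordered_eigenvector Cxunit z0 fz.
Unshelve. all: by end_near. Qed.

End MatrixLimits.

Lemma derive1_of_cvg (R : realType) (V : normedModType R) (f : R -> V) (l : V) :
  h^-1 *: (f h - f 0) @[h --> 0^'] --> l -> derivable f 0 1 /\ derive1 f 0 = l.
Proof.
move=> fl; split.
  apply/cvg_ex; exists l; move: fl; apply: cvg_trans; apply: near_eq_cvg.
  by apply: nearW => h /=; rewrite addr0 [h%:A]mulr1.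
rewrite /derive1; apply/cvg_lim => //; move: fl; apply: cvg_trans.
by apply: near_eq_cvg; apply: nearW => h /=; rewrite addr0.
Qed.

(** * Laplacians and their left zero-eigenvector *)

Section Laplacian.
Context {R : realType} {n : nat}.
Implicit Types A P : 'M[R]_n.

Lemma laplacianD A P : laplacian (A + P) = laplacian A + laplacian P.
Proof.
apply/matrixP => i j; rewrite !mxE.
under eq_bigr do rewrite mxE.
by rewrite big_split mulrnDl opprD addrACA.
Qed.

Lemma laplacianZ (e : R) P : laplacian (e *: P) = e *: laplacian P.
Proof.
apply/matrixP => i j; rewrite !mxE.
under eq_bigr do rewrite mxE.
by rewrite -mulr_sumr mulrBr mulrnAr.
Qed.

Lemma laplacian_rows_sum A : laplacian A *m const_mx 1 = 0 :> 'cV[R]_n.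
Proof.
apply/matrixP => i j; rewrite mulmxBl mul_diag_mx !mxE mulr1.
by under [X in _ - X]eq_bigr do rewrite mxE mulr1; rewrite subrr.
Qed.

Lemma mul_tr_const1 p (x : 'cV[R]_n) :
  x^T *m const_mx 1 = (\sum_i x i 0) *: const_mx 1 :> 'rV[R]_p.
Proof.
apply/matrixP => i j; rewrite !mxE mulr1 ord1.
by apply: eq_bigr => k _; rewrite !mxE mulr1.
Qed.

(** [const_mx 1] is the all-ones matrix [J].  Adding it makes [L] invertible and
    turns the homogeneous equation and the normalization of [xi] into a single
    linear system. *)
Definition anchored A : 'M[R]_n := laplacian A + const_mx 1.

(** Since [L] kills the all-ones column, multiplying [x^T (L + J) = (1, ..., 1)]
    by that column gives [n * sum x = n]; this recovers the normalization, and
    then [x^T L = 0]. *)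
Lemma left_zero_vectorsP A (x : 'cV[R]_n) : (0 < n)%N ->
  left_zero_vectors (laplacian A) x <-> x^T *m anchored A = const_mx 1.
Proof.
move=> n_gt0; rewrite /left_zero_vectors /anchored /=.
rewrite [x^T *m (_ + const_mx 1)]mulmxDr mul_tr_const1.
split=> [[-> ->]|xG]; first by rewrite add0r scale1r.
have sum1 : \sum_i x i 0 = 1.
  have := congr1 (mulmx^~ (const_mx 1 : 'cV[R]_n)) xG.
  rewrite mulmxDl -mulmxA laplacian_rows_sum mulmx0 add0r -scalemxAl => /matrixP/(_ 0 0).
  rewrite mxE; set c := (X in _ * X) => sc.
  have c0 : c != 0.
    rewrite /c mxE; under eq_bigr do rewrite !mxE mulr1.
    by rewrite sumr_const card_ord pnatr_eq0 -lt0n.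
  by apply: (mulIf c0); rewrite mul1r.
by split=> //; move: xG; rewrite sum1 scale1r => /(canRL (addrK _)); rewrite subrr.
Qed.

Lemma left_zero_vectors_unique A (x : 'cV[R]_n) : (0 < n)%N ->
  anchored A \in unitmx -> left_zero_vectors (laplacian A) x ->
  x = (const_mx 1 *m invmx (anchored A))^T.
Proof.
move=> n_gt0 Gunit /left_zero_vectorsP -/(_ n_gt0) xG.
by rewrite -xG mulmxK // trmxK.
Qed.

Lemma left_zero_vector_anchored A : (0 < n)%N -> anchored A \in unitmx ->
  left_zero_vectors (laplacian A) (left_zero_vector A).
Proof.
move=> n_gt0 Gunit; rewrite /left_zero_vector.
pose x : 'cV[R]_n := (const_mx 1 *m invmx (anchored A))^T.
by case: xgetP => // /(_ x); case; apply/left_zero_vectorsP; rewrite // trmxK mulmxKV.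
Qed.

(** [J] is the border [1 1^T], and the left and right zero-eigenvectors [xi] and
    [1] both have a nonzero scalar product with [1]. *)
Lemma anchored_unitmx A : (0 < n)%N ->
    simple_eigenvalue (laplacian A) 0 ->
    left_zero_vectors (laplacian A) (left_zero_vector A) ->
  anchored A \in unitmx.
Proof.
move=> n_gt0 simp [xL x1].
pose one : 'cV[R]_n := const_mx 1.
have -> : anchored A = laplacian A - 0%:M + one *m one^T.
  congr (_ + _); first by rewrite raddf0 subr0.
  by apply/matrixP => i j; rewrite !mxE big_ord1 !mxE mulr1.
apply: (bordered_unitmx (v := one) (u := left_zero_vector A) simp).
- by rewrite laplacian_rows_sum scale0r.
- by rewrite xL scale0r.
- by rewrite mul_tr_const1 x1 scale1r mxE oner_eq0.
- rewrite mul_tr_const1 !mxE mulr1; under eq_bigr do rewrite mxE.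
  by rewrite sumr_const card_ord pnatr_eq0 -lt0n.
Qed.

(** The stiffness matrix [S] of the generalized eigenproblem
    [S y = kappa Xi y], of which [Xi] is the mass matrix. *)
Definition sym_Xi_laplacian A : 'M[R]_n :=
  2^-1 *: (Xi A *m laplacian A + (laplacian A)^T *m Xi A).

Lemma Xi_sym A : (Xi A)^T = Xi A. Proof. exact: tr_diag_mx. Qed.

Lemma Xi_invsqrt_sym A : (Xi_invsqrt A)^T = Xi_invsqrt A.
Proof. exact: tr_diag_mx. Qed.

Lemma sym_Xi_laplacian_sym A : (sym_Xi_laplacian A)^T = sym_Xi_laplacian A.
Proof. by rewrite linearZ /= linearD /= !trmx_mul trmxK Xi_sym addrC. Qed.

Lemma sym_laplacian_sym A : (sym_laplacian A)^T = sym_laplacian A.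
Proof.
rewrite /sym_laplacian -/(sym_Xi_laplacian A) !trmx_mul sym_Xi_laplacian_sym.
by rewrite Xi_invsqrt_sym mulmxA.
Qed.

Lemma Xi_invsqrtK A : (forall i, 0 < left_zero_vector A i 0) ->
  Xi_invsqrt A *m Xi A *m Xi_invsqrt A = 1%:M.
Proof.
move=> xi_gt0; apply/matrixP => i j; rewrite mul_mx_diag mul_diag_mx !mxE.
case: eqP => [->|_]; rewrite ?mulr0n ?mulr1n ?mulr0 ?mul0r // mulrAC -expr2 exprVn.
by rewrite sqr_sqrtr ?ltW // mulVf ?gt_eqF.
Qed.

Lemma generalized_eigenvector A (v : 'cV[R]_n) (a : R) :
    (forall i, 0 < left_zero_vector A i 0) -> sym_laplacian A *m v = a *: v ->
  sym_Xi_laplacian A *m (Xi_invsqrt A *m v) = a *: (Xi A *m (Xi_invsqrt A *m v)).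
Proof.
move=> xi_gt0 Mv; have BXB := Xi_invsqrtK xi_gt0.
have Bunit : Xi_invsqrt A \in unitmx.
  by case: (mulmx1_unit BXB).
apply: (can_inj (mulKmx Bunit)).
by rewrite -scalemxAr !mulmxA BXB mul1mx -Mv.
Qed.

(** The heart of the perturbation formula.  The equation of [y'] is multiplied
    by [y^T] on the left and the transposed equation of [y] by [y'] on the
    right; the symmetry of [S] and [X] makes the difference an exact expression
    for [a' - a], linear in the increments [S' - S] and [X' - X]. *)
Lemma eigenpair_difference (S S' X X' : 'M[R]_n) (a a' : R) (y y' : 'cV[R]_n) :
    S^T = S -> X^T = X -> S *m y = a *: (X *m y) -> S' *m y' = a' *: (X' *m y') ->
  (a' - a) *: (y^T *m X' *m y') =
  y^T *m (S' - S) *m y' - a *: (y^T *m (X' - X) *m y').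
Proof.
move=> symS symX Sy S'y'.
have yS : y^T *m S = a *: (y^T *m X).
  by rewrite -{1}symS -trmx_mul Sy linearZ /= trmx_mul symX.
rewrite mulmxBr !mulmxBl yS -[y^T *m S' *m y']mulmxA S'y' -scalemxAr -scalemxAl mulmxA.
by rewrite mulmxBr mulmxBl scalerBr scalerBl opprB addrA subrK.
Qed.

(** By linearity only one edge [j -> i] matters; its Laplacian has the single
    nonzero row [i], which sends [y] to [y_i - y_j]. *)
Lemma edge_quadform (F : {set 'I_n * 'I_n}) (d : 'rV[R]_n) (y : 'cV[R]_n) :
  (y^T *m (diag_mx d *m laplacian (\sum_(e in F) delta_mx e.2 e.1)) *m y) 0 0 =
  \sum_(e in F) d 0 e.2 * y e.2 0 * (y e.2 0 - y e.1 0).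
Proof.
have lap0 : laplacian (0 : 'M[R]_n) = 0.
  by rewrite -(scale0r (0 : 'M[R]_n)) laplacianZ !scale0r.
rewrite (big_morph _ laplacianD lap0) mulmx_sumr mulmx_sumr mulmx_suml summxE.
apply: eq_bigr => e _.
rewrite mulmxA -mulmxA.
have -> : laplacian (delta_mx e.2 e.1) *m y =
   (y e.2 0 - y e.1 0) *: delta_mx e.2 0 :> 'cV[R]_n.
  have deg i : \sum_j (delta_mx e.2 e.1 : 'M[R]_n) i j = (i == e.2)%:R.
    rewrite (bigD1 e.1) //= big1 => [|k /negPf ke]; last by rewrite mxE ke andbF.
    by rewrite mxE eqxx andbT addr0.
  have act i : \sum_j (delta_mx e.2 e.1 : 'M[R]_n) i j * y j 0 = (i == e.2)%:R * y e.1 0.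
    rewrite (bigD1 e.1) //= big1 => [|k /negPf ke]; last by rewrite mxE ke andbF mul0r.
    by rewrite mxE eqxx andbT addr0.
  apply/matrixP => i j; rewrite ord1 mulmxBl mul_diag_mx [LHS]mxE [X in X + _]mxE.
  rewrite [X in _ + X]mxE [X in _ - X]mxE act [X in X * _]mxE deg !mxE andbT -mulrBr mulrC.
  by case: eqP => [->|_]; rewrite ?mulr0.
rewrite -scalemxAr -colE mxE mxE mul_mx_diag !mxE mulrC.
by congr (_ * _); rewrite mulrC.
Qed.
End Laplacian.

(** * First-order expansion along a line of weight matrices *)

Lemma symmetrized_product_diffquot (R : numFieldType) n (h : R) (X X' L K : 'M[R]_n) :
  h != 0 ->
  h^-1 *: (2^-1 *: (X' *m (L + h *: K) + (L + h *: K)^T *m X')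
           - 2^-1 *: (X *m L + L^T *m X)) =
  2^-1 *: ((h^-1 *: (X' - X)) *m L + X' *m K
           + (L^T *m (h^-1 *: (X' - X)) + K^T *m X')).
Proof.
move=> h0; rewrite -scalerBr scalerA [_ * 2^-1]mulrC -scalerA; congr (_ *: _).
have -> : (L + h *: K)^T = L^T + h *: K^T by rewrite linearD linearZ.
rewrite mulmxDr mulmxDl -scalemxAl -!scalemxAr -!scalemxAl mulmxBl mulmxBr.
rewrite opprD addrACA scalerDr.
by congr (_ + _); rewrite addrAC scalerDr scalerA mulVf // scale1r.
Qed.

Section Perturbation.
Context {R : realType} {n : nat}.
Context (A P : 'M[R]_n) (n_gt0 : (0 < n)%N) (Gunit : anchored A \in unitmx).

Let A_ (e : R) := A + e *: P.

Lemma anchored_line e : anchored (A_ e) = anchored A + e *: laplacian P.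
Proof. by rewrite /anchored laplacianD laplacianZ addrAC. Qed.

Lemma cvg_line (B D : 'M[R]_n) : B + e *: D @[e --> (0 : R)] --> B.
Proof.
rewrite -[X in _ --> X]addr0 -(scale0r D).
by apply: cvgD; [exact: cvg_cst | apply: cvgZ; [exact: cvg_id | exact: cvg_cst]].
Qed.

Lemma cvg_anchored : anchored (A_ e) @[e --> (0 : R)] --> anchored A.
Proof. by under eq_cvg do rewrite anchored_line; exact: cvg_line. Qed.

Lemma near_anchored_unitmx : \forall e \near (0 : R), anchored (A_ e) \in unitmx.
Proof. exact: near_unitmx cvg_anchored Gunit. Qed.

Lemma cvg_left_zero_vector : left_zero_vector (A_ e) @[e --> (0 : R)] --> left_zero_vector A.
Proof.
have xiE (B : 'M[R]_n) : anchored B \in unitmx ->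
    left_zero_vector B = (const_mx 1 *m invmx (anchored B))^T.
  by move=> Bunit; apply: left_zero_vectors_unique => //;
    exact: (left_zero_vector_anchored n_gt0 Bunit).
rewrite (xiE A Gunit).
apply: (@cvg_trans _ ((const_mx 1 *m invmx (anchored (A_ e)))^T @[e --> (0 : R)])).
  apply: near_eq_cvg; near=> e; rewrite xiE //.
  by near: e; exact: near_anchored_unitmx.
exact: cvg_trmx (cvg_mulmx (cvg_cst _) (cvg_invmx cvg_anchored Gunit)).
Unshelve. all: by end_near. Qed.

(** What one gets by differentiating [xi(e)^T (L(e) + J) = (1, ..., 1)] at
    [e = 0], where [L' = laplacian P]. *)
Definition left_zero_vector_deriv : 'cV[R]_n :=
  - ((left_zero_vector A)^T *m laplacian P *m invmx (anchored A))^T.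

(** Subtracting the linear systems at [h] and at [0] gives
    [(xi(h) - xi)^T (L + J) = - h xi(h)^T L'] exactly, so the difference
    quotient converges as soon as [xi(h)] does. *)
Lemma left_zero_vector_diffquot :
  h^-1 *: (left_zero_vector (A_ h) - left_zero_vector A) @[h --> (0 : R)^'] -->
  left_zero_vector_deriv.
Proof.
apply: (@cvg_trans _
  (- ((left_zero_vector (A_ h))^T *m laplacian P *m invmx (anchored A))^T @[h --> (0 : R)^'])).
  apply: near_eq_cvg; near=> h.
  have h0 : h != 0 by near: h; exact: nbhs_dnbhs_neq.
  have Gh : anchored (A_ h) \in unitmx.
    by near: h; apply: nbhs_dnbhs; exact: near_anchored_unitmx.
  have /left_zero_vectorsP -/(_ n_gt0) xiG := left_zero_vector_anchored n_gt0 Gunit.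
  have /left_zero_vectorsP -/(_ n_gt0) := left_zero_vector_anchored n_gt0 Gh.
  rewrite anchored_line mulmxDr -scalemxAr => xihG.
  apply: trmx_inj; rewrite linearN /= trmxK linearZ /= [in RHS]linearB /=.
  apply: (can_inj (mulmxK Gunit)).
  rewrite mulNmx mulmxKV // -scalemxAl [in RHS]mulmxBl xiG -xihG.
  by rewrite opprD addrA subrr add0r scalerN scalerA mulVf // scale1r.
have xih : left_zero_vector (A_ h) @[h --> (0 : R)^'] --> left_zero_vector A.
  by apply: cvg_within_filter; exact: cvg_left_zero_vector.
apply: cvgN.
exact: cvg_trmx (cvg_mulmx (cvg_mulmx (cvg_trmx xih) (cvg_cst _)) (cvg_cst _)).
Unshelve. all: by end_near. Qed.

Lemma cvg_Xi : Xi (A_ e) @[e --> (0 : R)] --> Xi A.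
Proof. exact: cvg_diag_mx (cvg_trmx cvg_left_zero_vector). Qed.

Lemma Xi_diffquot :
  h^-1 *: (Xi (A_ h) - Xi A) @[h --> (0 : R)^'] --> diag_mx left_zero_vector_deriv^T.
Proof.
under eq_cvg do rewrite /Xi -linearB -linearZ /= -linearB -linearZ /=.
exact: cvg_diag_mx (cvg_trmx left_zero_vector_diffquot).
Qed.

Context (xi_gt0 : forall i, 0 < left_zero_vector A i 0).

Lemma near_left_zero_vector_gt0 :
  \forall e \near (0 : R), forall i, 0 < left_zero_vector (A_ e) i 0.
Proof.
apply: (@filter_forall _ _ (fun i e => 0 < left_zero_vector (A_ e) i 0) (nbhs (0 : R))) => i.
have /cvg_mxP/(_ i 0) := cvg_left_zero_vector.
by move=> /cvgr_gt; apply.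
Qed.

Lemma cvg_Xi_invsqrt : Xi_invsqrt (A_ e) @[e --> (0 : R)] --> Xi_invsqrt A.
Proof.
apply: cvg_diag_mx; apply/cvg_mxP => i j; rewrite mxE.
under eq_cvg do rewrite mxE.
apply: cvgV; first by rewrite gt_eqF // sqrtr_gt0.
have /cvg_mxP/(_ j 0) xij := cvg_left_zero_vector.
exact: (cvg_comp _ Num.sqrt xij (@sqrt_continuous R _)).
Qed.

Lemma cvg_laplacian : laplacian (A_ e) @[e --> (0 : R)] --> laplacian A.
Proof. by under eq_cvg do rewrite laplacianD laplacianZ; exact: cvg_line. Qed.

Lemma cvg_sym_laplacian : sym_laplacian (A_ e) @[e --> (0 : R)] --> sym_laplacian A.
Proof.
have cL := cvg_laplacian; have cXi := cvg_Xi; have cB := cvg_Xi_invsqrt.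
apply: (cvg_mulmx (cvg_mulmx cB _) cB); apply: cvgZ; first exact: cvg_cst.
exact: cvgD (cvg_mulmx cXi cL) (cvg_mulmx (cvg_trmx cL) cXi).
Qed.

Definition sym_Xi_laplacian_deriv : 'M[R]_n :=
  2^-1 *: (diag_mx left_zero_vector_deriv^T *m laplacian A + Xi A *m laplacian P
    + ((laplacian A)^T *m diag_mx left_zero_vector_deriv^T + (laplacian P)^T *m Xi A)).

Lemma sym_Xi_laplacian_diffquot :
  h^-1 *: (sym_Xi_laplacian (A_ h) - sym_Xi_laplacian A) @[h --> (0 : R)^'] -->
  sym_Xi_laplacian_deriv.
Proof.
pose q h := h^-1 *: (Xi (A_ h) - Xi A).
apply: (@cvg_trans _ (2^-1 *: (q h *m laplacian A + Xi (A_ h) *m laplacian P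
    + ((laplacian A)^T *m q h + (laplacian P)^T *m Xi (A_ h))) @[h --> (0 : R)^'])).
  apply: near_eq_cvg; near=> h.
  have h0 : h != 0 by near: h; exact: nbhs_dnbhs_neq.
  by rewrite /sym_Xi_laplacian laplacianD laplacianZ [RHS]symmetrized_product_diffquot.
have cXi : Xi (A_ h) @[h --> (0 : R)^'] --> Xi A.
  by apply: cvg_within_filter; exact: cvg_Xi.
apply: cvgZ; first exact: cvg_cst.
have cq := Xi_diffquot.
exact: cvgD (cvgD (cvg_mulmx cq (cvg_cst _)) (cvg_mulmx cXi (cvg_cst _)))
  (cvgD (cvg_mulmx (cvg_cst _) cq) (cvg_mulmx (cvg_cst _) cXi)).
Unshelve. all: by end_near. Qed.

End Perturbation.

(** The two halves of the symmetrization are transposes of each other and have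
    the same quadratic form. *)
Lemma sym_Xi_laplacian_deriv_quadform (R : realType) n (A P : 'M[R]_n) (y : 'cV[R]_n) :
  (y^T *m sym_Xi_laplacian_deriv A P *m y) 0 0 =
  (y^T *m (diag_mx (left_zero_vector_deriv A P)^T *m laplacian A) *m y) 0 0
  + (y^T *m (Xi A *m laplacian P) *m y) 0 0.
Proof.
pose qf (N : 'M[R]_n) := (y^T *m N *m y) 0 0.
have qfD N N' : qf (N + N') = qf N + qf N' by rewrite /qf mulmxDr mulmxDl mxE.
have qfZ c N : qf (c *: N) = c * qf N by rewrite /qf -scalemxAr -scalemxAl mxE.
have qfT N : qf N^T = qf N.
  have trE (B : 'M[R]_1) : B 0 0 = B^T 0 0 by rewrite mxE.
  by rewrite /qf [RHS]trE !trmx_mul trmxK mulmxA.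
have qfS (X K : 'M[R]_n) : X^T = X -> qf (K^T *m X) = qf (X *m K).
  by move=> symX; rewrite -[RHS]qfT trmx_mul symX.
rewrite -![(y^T *m _ *m y) 0 0]/(qf _) /sym_Xi_laplacian_deriv qfZ !qfD.
rewrite (qfS _ _ (tr_diag_mx _)) (qfS _ _ (Xi_sym A)).
by field.
Qed.

(** * The derivative of the generalized algebraic connectivity *)

Section Connectivity.
Context {R : realType} {n : nat}.
Context (A P : 'M[R]_n) (n_ge2 : (2 <= n)%N) (Gunit : anchored A \in unitmx).
Context (xi_gt0 : forall i, 0 < left_zero_vector A i 0).
Let kappa := gen_alg_connectivity A.
Context (kappa_simple : simple_eigenvalue (sym_laplacian A) kappa).
Context (v : 'cV[R]_n) (v_unit : v^T *m v = 1%:M).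
Context (v_eigen : sym_laplacian A *m v = kappa *: v).
Let y := Xi_invsqrt A *m v.
Let A_ (e : R) := A + e *: P.

Lemma y_normalized : y^T *m Xi A *m y = 1%:M.
Proof.
have := Xi_invsqrtK xi_gt0.
rewrite /y trmx_mul Xi_invsqrt_sym -!mulmxA => BXB.
by rewrite [Xi_invsqrt A *m _]mulmxA [X in v^T *m X]mulmxA -[X in X *m v]mulmxA BXB mul1mx.
Qed.

(** [eigenpair_difference] expresses the difference quotient of [kappa] through
    those of [S] and [Xi], with a denominator that tends to [y^T Xi y = 1]. *)
Lemma gen_alg_connectivity_diffquot :
  h^-1 * (gen_alg_connectivity (A_ h) - kappa) @[h --> (0 : R)^'] -->
  (y^T *m sym_Xi_laplacian_deriv A P *m y) 0 0
    - kappa * (y^T *m diag_mx (left_zero_vector_deriv A P)^T *m y) 0 0.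
Proof.
have n_gt0 : (0 < n)%N by exact: leq_trans n_ge2.
have punct (T : topologicalType) (f : R -> T) (l : T) :
  f @ (0 : R) --> l -> f @ (0 : R)^' --> l by exact: cvg_within_filter.
have cM := punct _ _ _ (cvg_sym_laplacian P n_gt0 Gunit xi_gt0).
have cXi := punct _ _ _ (cvg_Xi P n_gt0 Gunit).
have cB := punct _ _ _ (cvg_Xi_invsqrt P n_gt0 Gunit xi_gt0).
have [g [gv gP]] := cvg_lambda2_eigenvector n_ge2 (fun h => sym_laplacian_sym (A_ h))
  (sym_laplacian_sym A) cM kappa_simple v_unit v_eigen.
pose z h := Xi_invsqrt (A_ h) *m g h.
have zy : z h @[h --> (0 : R)^'] --> y by exact: cvg_mulmx cB gv.
have cyz (f : R -> 'M[R]_n) (l : 'M[R]_n) : f @ (0 : R)^' --> l ->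
    (y^T *m f h *m z h) 0 0 @[h --> (0 : R)^'] --> (y^T *m l *m y) 0 0.
  move=> fl; have : y^T *m f h *m z h @[h --> (0 : R)^'] --> y^T *m l *m y.
    exact: cvg_mulmx (cvg_mulmx (cvg_cst _) fl) zy.
  by move=> /cvg_mxP; exact.
have norm1 : (y^T *m Xi A *m y) 0 0 = 1 by rewrite y_normalized mxE.
have cden := cyz _ _ cXi.
pose q h := ((y^T *m (h^-1 *: (sym_Xi_laplacian (A_ h) - sym_Xi_laplacian A)) *m z h) 0 0
  - kappa * (y^T *m (h^-1 *: (Xi (A_ h) - Xi A)) *m z h) 0 0)
  / (y^T *m Xi (A_ h) *m z h) 0 0.
apply: (@cvg_trans _ (q h @[h --> (0 : R)^'])).
  apply: near_eq_cvg; near=> h.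
  have den0 : (y^T *m Xi (A_ h) *m z h) 0 0 != 0.
    near: h; apply: cvgr_neq0 cden _; by rewrite norm1 oner_eq0.
  have Mg : sym_laplacian (A_ h) *m g h = gen_alg_connectivity (A_ h) *: g h.
    by near: h.
  have xih : forall i, 0 < left_zero_vector (A_ h) i 0.
    by near: h; apply: nbhs_dnbhs; exact: near_left_zero_vector_gt0.
  have := eigenpair_difference (sym_Xi_laplacian_sym A) (Xi_sym A)
    (generalized_eigenvector xi_gt0 v_eigen) (generalized_eigenvector xih Mg).
  rewrite -/y -/(z h) => /matrixP/(_ 0 0).
  have scal c (N : 'M[R]_1) : (c *: N) 0 0 = c * N 0 0 by rewrite mxE.
  have subE (N N' : 'M[R]_1) : (N - N') 0 0 = N 0 0 - N' 0 0 by rewrite !mxE.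
  rewrite subE !scal => dk.
  apply: (mulIf den0); rewrite /q divfK // -mulrA dk mulrBr.
  by rewrite -!scalemxAr -!scalemxAl !scal mulrCA.
suff : q h @[h --> (0 : R)^'] -->
    ((y^T *m sym_Xi_laplacian_deriv A P *m y) 0 0
    - kappa * (y^T *m diag_mx (left_zero_vector_deriv A P)^T *m y) 0 0)
    / (y^T *m Xi A *m y) 0 0 by rewrite norm1 divr1.
apply: cvgM; last by apply: cvgV => //; rewrite norm1 oner_eq0.
apply: cvgB; first by apply: cyz; exact: sym_Xi_laplacian_diffquot.
apply: cvgM; first exact: cvg_cst.
by apply: cyz; exact: Xi_diffquot.
Unshelve. all: by end_near. Qed.

End Connectivity.

Theorem theorem1 (R : realType) (n : nat) (hn : (2 <= n)%N) (A : 'M[R]_n)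
    (hA : simple_weights A)
    (A1 : assumption_spectrum A)
    (A2 : assumption_left_vector A)
    (A3 : assumption_sym_laplacian A)
    (v : 'cV[R]_n)
    (hv : sym_laplacian A *m v = gen_alg_connectivity A *: v)
    (hv1 : norm2 v = 1)
    (F : {set 'I_n * 'I_n}) (hF : edge_set F) :
  let L := laplacian A in
  let xi := left_zero_vector A in
  let kappa := gen_alg_connectivity A in
  let y := Xi_invsqrt A *m v in
  let Xi_eps := fun eps : R => Xi (perturb A F eps) in
  let kappa_eps := fun eps : R => gen_alg_connectivity (perturb A F eps) in
  [/\ (\forall eps \near (0 : R),
         (exists! x : 'cV[R]_n,
            left_zero_vectors (laplacian (perturb A F eps)) x) /\
         (forall i, 0 < left_zero_vector (perturb A F eps) i 0)),
      derivable Xi_eps 0 1,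
      derivable kappa_eps 0 1 &
      derive1 kappa_eps 0 =
        \sum_(e in F) xi e.2 0 * y e.2 0 * (y e.2 0 - y e.1 0)
        + (y^T *m derive1 Xi_eps 0 *m (L - kappa%:M) *m y) 0 0].
Proof.
move=> L xi kappa y Xi_eps kappa_eps.
have [simpL _] := A1; have [xiL xi_gt0] := A2; have [_ _ simpk] := A3.
have n_gt0 : (0 < n)%N by exact: leq_trans hn.
have Gunit := anchored_unitmx n_gt0 simpL xiL.
have v1 : v^T *m v = 1%:M.
  rewrite [LHS]mx11_scalar sqnormE; congr (_%:M).
  have := hv1; rewrite /norm2 => /(congr1 (fun c => c ^+ 2)).
  rewrite sqr_sqrtr ?expr1n // sumr_ge0 // => i _; exact: sqr_ge0.
pose P : 'M[R]_n := \sum_(e in F) delta_mx e.2 e.1.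
have perturb0 : perturb A F 0 = A by rewrite /perturb scale0r addr0.
have [Xi_derivable Xi'] : derivable Xi_eps 0 1 /\ 
    derive1 Xi_eps 0 = diag_mx (left_zero_vector_deriv A P)^T.
  apply: derive1_of_cvg; rewrite /Xi_eps perturb0.
  exact: Xi_diffquot P n_gt0 Gunit.
have [kappa_derivable kappa'] : derivable kappa_eps 0 1 /\ derive1 kappa_eps 0 =
    (y^T *m sym_Xi_laplacian_deriv A P *m y) 0 0
    - kappa * (y^T *m diag_mx (left_zero_vector_deriv A P)^T *m y) 0 0.
  apply: derive1_of_cvg; rewrite /kappa_eps perturb0.
  exact: (gen_alg_connectivity_diffquot (P := P) hn Gunit xi_gt0 simpk v1 hv).
have edges : (y^T *m (Xi A *m laplacian P) *m y) 0 0 =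
    \sum_(e in F) xi e.2 0 * y e.2 0 * (y e.2 0 - y e.1 0).
  by rewrite [LHS]edge_quadform; apply: eq_bigr => e _; rewrite mxE.
have dXi_quadform (D : 'M[R]_n) : (y^T *m D *m (L - kappa%:M) *m y) 0 0 =
    (y^T *m (D *m L) *m y) 0 0 - kappa * (y^T *m D *m y) 0 0.
  have -> : y^T *m D *m (L - kappa%:M) *m y =
      y^T *m (D *m L) *m y - kappa *: (y^T *m D *m y).
    by rewrite mulmxBr mulmxBl mul_mx_scalar -scalemxAl !mulmxA.
  by rewrite mxE; congr (_ + _); rewrite !mxE.
split=> //; last first.
  rewrite kappa' Xi' dXi_quadform sym_Xi_laplacian_deriv_quadform edges.
  by rewrite -/L -addrA addrCA.
- near=> e; split; last by near: e; exact: near_left_zero_vector_gt0 P n_gt0 Gunit xi_gt0.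
  have Ge : anchored (perturb A F e) \in unitmx.
    by near: e; exact: near_anchored_unitmx P Gunit.
  exists (left_zero_vector (perturb A F e)); split.
    exact: (left_zero_vector_anchored n_gt0 Ge).
  move=> x /(left_zero_vectors_unique n_gt0 Ge) ->.
  exact: left_zero_vectors_unique n_gt0 Ge (left_zero_vector_anchored n_gt0 Ge).
Unshelve. all: by end_near. Qed.
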